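(* Let $\widehat z\in\mathbb R^n$, $F\in\mathbb R^{n\times m}$, $G\in\mathbb R^{n\times r}$, and $H\in\mathbb R^{n\times s}$ be given. Then the linear inequality system $$\widehat z+Fw+Gw'+Hw''=0,\quad w\in\mathbb R^m,\ w'\in\mathbb R^r_+,\ w''\in\mathbb R^s_{++}$$ has a solution if and only if the following linear program is solvable (attains an optimal solution) and has a positive optimal value: $$\max_{(w,w',w'',\varepsilon)\in\mathbb R^m\times\mathbb R^r\times\mathbb R^s\times\mathbb R}\ \varepsilon\quad\text{subject to}\quad\widehat z+Fw+Gw'+Hw''=0,\ \ w'\ge0,\ \ w''\ge\varepsilon\cdot\mathbf 1,\ \ \varepsilon\le1.$$
   Context: Vector inequalities are componentwise; $\mathbf 1$ is the vector of ones; $\mathbb R^n_+$ and $\mathbb R^n_{++}$ are the nonnegative and (strictly) positive orthants. *)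

(* Defs.v *)
From mathcomp Require Import all_boot all_order all_algebra.
From mathcomp Require Import classical_sets reals constructive_ereal ereal.
Set Implicit Arguments.
Unset Strict Implicit.
Unset Printing Implicit Defensive.
Import Order.TTheory GRing.Theory Num.Theory.
Local Open Scope classical_set_scope.
Local Open Scope ring_scope.

Definition lev (R : realType) (k : nat) (x y : 'cV[R]_k) : Prop :=
  forall i : 'I_k, x i 0 <= y i 0.

Definition ltv (R : realType) (k : nat) (x y : 'cV[R]_k) : Prop :=
  forall i : 'I_k, x i 0 < y i 0.

Definition ones (R : realType) (k : nat) : 'cV[R]_k := const_mx 1.
Arguments ones {R k}.

Section Maximization.
Variables (R : realType) (T : Type).

(* The maximization problem "max f x subject to x in S". *)

Definition optimal_solution (S : set T) (f : T -> R) (x : T) : Prop :=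
  S x /\ forall y : T, S y -> f y <= f x.

Definition max_solvable (S : set T) (f : T -> R) : Prop :=
  exists x : T, optimal_solution S f x.

(* Extended-real: -oo if the problem is infeasible, +oo if it is unbounded. *)
Definition max_value (S : set T) (f : T -> R) : \bar R :=
  ereal_sup [set (f x)%:E | x in S].

End Maximization.

Definition system_solution (R : realType) (n m r s : nat) (z : 'cV[R]_n)
    (F : 'M[R]_(n, m)) (G : 'M[R]_(n, r)) (H : 'M[R]_(n, s))
    (w : 'cV[R]_m) (w' : 'cV[R]_r) (w'' : 'cV[R]_s) : Prop :=
  [/\ z + F *m w + G *m w' + H *m w'' = 0, lev 0 w' & ltv 0 w''].

Definition lp_var (R : realType) (m r s : nat) : Type :=
  ('cV[R]_m * 'cV[R]_r * 'cV[R]_s * R)%type.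

Definition lp_feasible (R : realType) (n m r s : nat) (z : 'cV[R]_n)
    (F : 'M[R]_(n, m)) (G : 'M[R]_(n, r)) (H : 'M[R]_(n, s)) :
    set (lp_var R m r s) :=
  [set x | let: (w, w', w'', eps) := x in
    [/\ z + F *m w + G *m w' + H *m w'' = 0,
        lev 0 w', lev (eps *: ones) w'' & eps <= 1]].

Definition lp_objective (R : realType) (m r s : nat) (x : lp_var R m r s) : R :=
  let: (_, _, _, eps) := x in eps.

(* Main.v *)
(** Eliminating the variables [w, w', w''] one at a time (Fourier-Motzkin)
    shows that the feasible values of [eps] are cut out by finitely many weak
    affine inequalities on the line.  Such a set contains its supremum whenever
    it is nonempty and bounded above, and [eps <= 1] bounds it; hence the program
    is solvable as soon as it is feasible.  A solution of the strict system is
    feasible for [eps = min (1, min_i w''_i) > 0]. *)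

Require Import Defs.
From mathcomp Require Import all_boot all_order all_algebra lra.
From mathcomp Require Import classical_sets reals constructive_ereal ereal.
Set Implicit Arguments.
Unset Strict Implicit.
Unset Printing Implicit Defensive.
Import Order.TTheory GRing.Theory Num.Theory.
Local Open Scope ring_scope.

(** Bounds are inserted one at a time, correcting [t] by a [min] or a [max]. Either list may be
    empty, so one-sided or absent bounds are covered. *)
Lemma exists_between (R : realDomainType) (s1 s2 : seq R) :
  {in s1 & s2, forall x y, x <= y} ->
  exists t, {in s1, forall x, x <= t} /\ {in s2, forall y, t <= y}.
Proof.
elim: s1 => [_|x s1 IHs le12].
  elim: s2 => [|y s2 [t [_ tP]]]; first by exists 0.
  exists (Num.min y t); split=> // u; rewrite inE => /predU1P[->|/tP le_tu].
    by rewrite ge_min lexx.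
  by rewrite ge_min le_tu orbT.
have [|t [t1 t2]] := IHs.
  by move=> u v us vs; apply: le12; rewrite // inE us orbT.
exists (Num.max x t); split=> u.
  by rewrite inE le_max => /predU1P[->|/t1 ->]; rewrite ?lexx ?orbT.
by move=> us; rewrite ge_max t2 // le12 // mem_head.
Qed.

(* Right-hand sides live in an arbitrary module [V] and are evaluated by a linear
   form [phi]; this keeps track of the variables not yet eliminated without
   naming them. *)
Definition fourier_motzkin (R : realFieldType) (V : lmodType R)
    (L : seq (R * V)) : seq V :=
  [seq c.2 | c <- L & c.1 == 0] ++
  [seq p.1 *: q.2 - q.1 *: p.2 | p <- [seq c <- L | 0 < c.1],
                                 q <- [seq c <- L | c.1 < 0]].

(** A constraint with [c.1 > 0] bounds [t] below by [- phi c.2 / c.1], one with [c.1 < 0] bounds it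
    above by the same quotient. Cross-multiplied, lower bound at most upper bound is the condition
    on a pair. *)
Lemma fourier_motzkinP (R : realFieldType) (V : lmodType R) (L : seq (R * V))
    (phi : V -> R) : scalar phi ->
  (exists t, {in L, forall c, 0 <= c.1 * t + phi c.2}) <->
  {in fourier_motzkin L, forall v, 0 <= phi v}.
Proof.
move=> phi_lin.
have phi0 : phi 0 = 0.
  by have := phi_lin (-1) 0 0; rewrite scaler0 addr0 mulN1r addNr.
have phiE a b u v : phi (a *: u - b *: v) = a * phi u - b * phi v.
  rewrite phi_lin; congr (_ + _).
  by have := phi_lin (- b) v 0; rewrite !addr0 phi0 addr0 scaleNr mulNr.
split=> [[t tP] v|fmP].
  rewrite mem_cat => /orP[/mapP[c]|/allpairsP[[p q] /=]].
    by rewrite mem_filter => /andP[/eqP c0 /tP]; rewrite c0 mul0r add0r => ? ->.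
  rewrite !mem_filter => -[/andP[p0 /tP Hp] /andP[q0 /tP Hq] ->].
  (* Adding [Hq] times [p.1] and [Hp] times [- q.1] cancels [t]. *)
  by rewrite phiE; nra.
have [|t [tlo tup]] := @exists_between R
    [seq - phi c.2 / c.1 | c <- L & 0 < c.1]
    [seq - phi c.2 / c.1 | c <- L & c.1 < 0].
  move=> x y /mapP[p pL ->] /mapP[q qL ->].
  have /fmP : p.1 *: q.2 - q.1 *: p.2 \in fourier_motzkin L.
    by rewrite mem_cat; apply/orP; right; apply/allpairsP; exists (p, q).
  rewrite phiE => pq; move: pL qL; rewrite !mem_filter => /andP[p0 _] /andP[q0 _].
  rewrite ler_pdivrMr // mulrAC ler_ndivlMr //.
  by lra.
exists t => c cL; case: (ltgtP c.1 0) => c0.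
- have /tup : - phi c.2 / c.1 \in [seq - phi c.2 / c.1 | c <- L & c.1 < 0].
    by apply: map_f; rewrite mem_filter c0.
  by rewrite ler_ndivlMr //; lra.
- have /tlo : - phi c.2 / c.1 \in [seq - phi c.2 / c.1 | c <- L & 0 < c.1].
    by apply: map_f; rewrite mem_filter c0.
  by rewrite ler_pdivrMr //; lra.
- rewrite c0 mul0r add0r; apply: fmP; rewrite mem_cat; apply/orP; left.
  by apply: map_f; rewrite mem_filter c0 eqxx.
Qed.

(** Induction on [k], eliminating the first coordinate and then the others. [L'] is chosen before
    [phi], so that one list later serves all values of [eps]. *)
Lemma eliminate_vector (R : realFieldType) (k : nat) (V : lmodType R)
    (L : seq ('rV[R]_k * V)) :
  exists L' : seq V, forall phi : V -> R, scalar phi ->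
    (exists x : 'cV[R]_k, {in L, forall c, 0 <= (c.1 *m x) 0 0 + phi c.2}) <->
    {in L', forall v, 0 <= phi v}.
Proof.
elim: k V L => [|k IHk] V L.
  exists [seq c.2 | c <- L] => phi _; split=> [[x xP] _ /mapP[c cL ->]|LP].
    by have := xP c cL; rewrite mxE big_ord0 add0r.
  by exists 0 => c cL; rewrite mulmx0 mxE add0r LP // map_f.
pose split_first (c : 'rV[R]_(1 + k) * V) :=
  (lsubmx c.1 0 0, (rsubmx c.1, c.2)) : R * ('rV[R]_k * V).
have [L' L'P] := IHk _ (fourier_motzkin (map split_first L)).
exists L' => phi phi_lin; rewrite -L'P //.
(* With the other coordinates [x] fixed, their contribution joins the right-hand side, now in the
   module ['rV_k * V]; [psi x] is the linear form evaluating it. *)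
pose psi (x : 'cV[R]_k) (u : 'rV[R]_k * V) := (u.1 *m x) 0 0 + phi u.2.
have psi_lin x : scalar (psi x).
  move=> a u v; rewrite /psi /= phi_lin mulmxDl -scalemxAl !mxE mulrDr.
  by rewrite addrACA.
have splitE (c : 'rV[R]_(1 + k) * V) (x : 'cV[R]_(1 + k)) :
    (c.1 *m x) 0 0 + phi c.2 =
    (split_first c).1 * usubmx x 0 0 + psi (dsubmx x) (split_first c).2.
  rewrite -{1}[c.1]hsubmxK -{1}[x]vsubmxK mul_row_col mxE -addrA /psi /=.
  by congr (_ + _); rewrite mxE big_ord1.
split=> [[x xP]|[x /(fourier_motzkinP _ (psi_lin x))[t tP]]].
  exists (dsubmx (x : 'cV_(1 + k))); apply/(fourier_motzkinP _ (psi_lin _)).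
  exists (usubmx (x : 'cV_(1 + k)) 0 0) => _ /mapP[c cL ->].
  by rewrite -splitE xP.
exists (col_mx t%:M x : 'cV_(1 + k)) => c cL.
rewrite splitE col_mxKu col_mxKd mxE eqxx mulr1n.
by apply: tP; apply: map_f.
Qed.

(** The supremum satisfies each constraint: for a nonnegative slope because it is at least [t0], for
    a negative slope because the constraint is itself an upper bound of [S]. *)
Lemma affine_constraints_max (R : realType) (L : seq (R^o * R^o)) (t0 M : R) :
  let S := [set t : R | {in L, forall c, 0 <= c.1 * t + c.2}]%classic in
  S t0 -> (forall t, S t -> t <= M) -> exists2 t, S t & forall u, S u -> u <= t.
Proof.
move=> S St0 SM.
have ubS : has_ubound S by exists M.
have le_sup u : S u -> u <= sup S by apply: ub_le_sup.
exists (sup S) => // c cL.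
have [c0|c0] := leP 0 c.1.
  apply: le_trans (St0 c cL) _.
  by rewrite lerD2r ler_wpM2l // le_sup.
suff : sup S <= - c.2 / c.1 by rewrite ler_ndivlMr //; lra.
apply: ge_sup; first by exists t0.
by move=> u Su; rewrite ler_ndivlMr //; have := Su c cL; lra.
Qed.

(** The equation is split into two opposite inequalities per row, and then all of [w], [w'], [w'']
    is eliminated as one stacked vector. *)
Lemma lp_feasible_values (R : realType) (n m r s : nat) (z : 'cV[R]_n)
    (F : 'M[R]_(n, m)) (G : 'M[R]_(n, r)) (H : 'M[R]_(n, s)) :
  exists L : seq (R^o * R^o), forall eps : R,
    (exists w w' w'', lp_feasible z F G H (w, w', w'', eps)) <->
    {in L, forall c, 0 <= c.1 * eps + c.2}.
Proof.
pose A := row_mx F (row_mx G H).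
pose e (j : 'I_(m + (r + s))) : 'rV[R]_(m + (r + s)) := delta_mx 0 j.
(* [(c, (a, b))] encodes [0 <= c x + a eps + b], where [x] stacks [w, w', w'']. *)
pose L : seq ('rV[R]_(m + (r + s)) * (R^o * R^o)) :=
  [seq (row i A, (0, z i 0)) | i <- enum 'I_n] ++
  [seq (- row i A, (0, - z i 0)) | i <- enum 'I_n] ++
  [seq (e (rshift m (lshift s i)), (0, 0)) | i <- enum 'I_r] ++
  [seq (e (rshift m (rshift r i)), (-1, 0)) | i <- enum 'I_s] ++
  [:: (0, (-1, 1))].
have [L' L'P] := eliminate_vector L.
(* Here [phi (a, b) = a * eps + b], which for each fixed [eps] is linear in [(a, b)]. *)
exists L' => eps; rewrite -L'P; last first.
  by move=> a u v /=; rewrite /GRing.scale /=; lra.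
have AE w w' w'' : A *m col_mx w (col_mx w' w'') = F *m w + G *m w' + H *m w''.
  by rewrite !mul_row_col addrA.
have row_mulE (x : 'cV_(m + (r + s))) i : (row i A *m x) 0 0 = (A *m x) i 0.
  by rewrite -row_mul mxE.
have rowN_mulE (x : 'cV_(m + (r + s))) i :
    (- row i A *m x) 0 0 = - (A *m x) i 0.
  by rewrite mulNmx mxE row_mulE.
have eE j (x : 'cV_(m + (r + s))) : (e j *m x) 0 0 = x j 0.
  by rewrite -rowE mxE.
split=> [[w [w' [w'' [eq0 w'0 w''e eps1]]]]|[x xP]].
  exists (col_mx w (col_mx w' w'')) => c.
  have Az i : (A *m col_mx w (col_mx w' w'')) i 0 = - z i 0.
    have /matrixP/(_ i 0) := eq0.
    by rewrite AE -!addrA mxE [in RHS]mxE => /eqP; rewrite addrC addr_eq0 => /eqP.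
  rewrite !mem_cat => /or4P[/mapP[i _ ->]|/mapP[i _ ->]|/mapP[i _ ->]|
    /orP[/mapP[i _ ->]|]] /=.
  - by rewrite row_mulE Az mul0r add0r addNr.
  - by rewrite rowN_mulE Az mul0r add0r opprK subrr.
  - by rewrite eE col_mxEd col_mxEu mul0r !addr0; have := w'0 i; rewrite mxE.
  - rewrite eE !col_mxEd; have := w''e i; rewrite !mxE mulr1; lra.
  - by rewrite inE => /eqP -> /=; rewrite mul0mx mxE; lra.
move: xP; rewrite -[x]vsubmxK -[dsubmx x]vsubmxK.
set w := usubmx x; set w' := usubmx _; set w'' := dsubmx _ => xP.
exists w, w', w''; split.
- apply/matrixP=> i j; rewrite !ord1 -!addrA [F *m w + _]addrA -AE mxE [RHS]mxE.
  have H1 : (row i A, (0, z i 0)) \in L.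
    by rewrite !mem_cat map_f ?mem_enum.
  have H2 : (- row i A, (0, - z i 0)) \in L.
    rewrite !mem_cat.
    by rewrite (map_f (fun i => (- row i A, (0, - z i 0)))) ?mem_enum ?orbT.
  have := xP _ H1; have := xP _ H2; rewrite /= rowN_mulE row_mulE; lra.
- move=> i.
  have /xP /= : (e (rshift m (lshift s i)), (0, 0)) \in L.
    rewrite !mem_cat.
    by rewrite (map_f (fun i => (e (rshift m (lshift s i)), (0, 0)))) ?mem_enum ?orbT.
  by rewrite eE col_mxEd col_mxEu mul0r !addr0 => w'0; rewrite mxE.
- move=> i.
  have /xP /= : (e (rshift m (rshift r i)), (-1, 0)) \in L.
    rewrite !mem_cat.
    by rewrite (map_f (fun i => (e (rshift m (rshift r i)), (-1, 0)))) ?mem_enum ?orbT.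
  by rewrite eE !col_mxEd => w''e; rewrite [leLHS]mxE mxE; lra.
- have /xP /= : (0, (-1, 1)) \in L by rewrite !mem_cat inE eqxx !orbT.
  by rewrite mul0mx mxE; lra.
Qed.

(** The objective depends on [eps] alone, so a largest feasible [eps], lifted back to a feasible
    point by [LP], is optimal. *)
Lemma lp_max_solvable (R : realType) (n m r s : nat) (z : 'cV[R]_n)
    (F : 'M[R]_(n, m)) (G : 'M[R]_(n, r)) (H : 'M[R]_(n, s)) x0 :
  lp_feasible z F G H x0 ->
  max_solvable (lp_feasible z F G H) (@lp_objective R m r s).
Proof.
case: x0 => [[[w0 w0'] w0''] eps0] feas0.
have [L LP] := lp_feasible_values z F G H.
have [||eps /LP[w [w' [w'' feas]]] eps_max] := @affine_constraints_max R L eps0 1.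
- by apply/LP; exists w0, w0', w0''.
- by move=> t /LP[w [w' [w'' []]]].
exists (w, w', w'', eps); split=> // -[[[v v'] v''] eps'] feas'.
by apply: eps_max; apply/LP; exists v, v', v''.
Qed.

Theorem lemma6p1 (R : realType) (n m r s : nat) (z : 'cV[R]_n)
    (F : 'M[R]_(n, m)) (G : 'M[R]_(n, r)) (H : 'M[R]_(n, s)) :
  (exists (w : 'cV[R]_m) (w' : 'cV[R]_r) (w'' : 'cV[R]_s),
      system_solution z F G H w w' w'')
  <->
  (max_solvable (lp_feasible z F G H) (@lp_objective R m r s) /\
   (0 < max_value (lp_feasible z F G H) (@lp_objective R m r s))%E).
Proof.
split=> [[w [w' [w'' [eq0 w'0 w''0]]]]|[_]].
  (* The default [1] ensures [eps <= 1] and handles [s = 0]. *)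
  pose eps := \big[Num.min/1]_(i < s) w'' i 0.
  have eps0 : 0 < eps.
    by apply: lt_bigmin => // i _; have := w''0 i; rewrite mxE.
  have feas : lp_feasible z F G H (w, w', w'', eps).
    split=> //; last exact: bigmin_le_id.
    by move=> i; rewrite !mxE mulr1; apply: bigmin_le.
  split; first exact: lp_max_solvable feas.
  apply: (@lt_le_trans _ _ eps%:E); first by rewrite lte_fin.
  by apply: ereal_sup_ubound; exists (w, w', w'', eps).
(* Since [0] lies strictly below the supremum, some feasible point has [eps > 0], which makes its
   [w''] strictly positive. *)
move=> /ereal_sup_gt[_ [[[[w w'] w''] eps] [eq0 w'0 w''eps _] <-]].
rewrite lte_fin /= => eps0; exists w, w', w''; split=> // i.
by rewrite mxE; apply: lt_le_trans eps0 _; have := w''eps i; rewrite !mxE mulr1.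
Qed.
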